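(* Let $\Phi(t,\omega)(x,\mu)=(\varphi_X(t,\omega,x,\mu),\varphi_P(t)\mu)$ be a product cocycle on $\mathbb X=X\times P$, where $\varphi_X,\varphi_P$ satisfy (P1)-(P4) of the context. Suppose that $\Phi$ has a $\mathfrak D$-pullback random attractor $\mathcal A$, that $\varphi_P$ has a $\mathfrak D_P$-global attractor $\mathcal A_P\in\mathfrak D_P$, and that $\mathfrak D_X$ is nonempty. For $\mu\in\mathcal A_P$ and $t\ge0$ set $$\Theta_{-t}\mu=\{\nu\in\mathcal A_P:\varphi_P(t)\nu=\mu\},\qquad A(\omega,\mu)=\{x\in X:(x,\mu)\in\mathcal A(\omega)\}.$$ Then, for every $t\ge0$, $\omega\in\Omega$ and $\mu\in\mathcal A_P$, $$A(\omega,\mu)=\bigcup_{\nu\in\Theta_{-t}\mu}\varphi_X\big(t,\theta_{-t}\omega,A(\theta_{-t}\omega,\nu),\nu\big).$$ Moreover, for every $B\in\mathfrak D_X$, $\omega\in\Omega$ and $\mu\in\mathcal A_P$, $$\lim_{t\to\infty}\sup_{\nu\in\Theta_{-t}\mu}\operatorname{dist}_X\Big(\varphi_X\big(t,\theta_{-t}\omega,B(\theta_{-t}\omega),\nu\big),A(\omega,\mu)\Big)=0.$$ Here $\varphi_X(t,\omega,C,\mu)=\{\varphi_X(t,\omega,x,\mu):x\in C\}$ for $C\subset X$.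
   Context: $(\Omega,\mathcal F,\mathbb P,\{\theta_t\}_{t\in\mathbb R})$ is a metric dynamical system; all pathwise statements are understood on a fixed measurable $\theta_t$-invariant set of full probability, again denoted $\Omega$. $X$ is a separable Banach space; $\mathcal P_2(X)$ is the set of Borel probability measures on $X$ with finite second moment, with the 2-Wasserstein metric $\mathcal W_{2,X}$; $P$ is a complete separable metric subspace of $(\mathcal P_2(X),\mathcal W_{2,X})$; $\mathbb X=X\times P$ has metric $d_{\mathbb X}((x,\mu),(y,\nu))=\|x-y\|_X+\mathcal W_{2,X}(\mu,\nu)$. $\mathbb R^+=[0,\infty)$. Product cocycle: $\varphi_X:\mathbb R^+\times\Omega\times X\times P\to X$ and $\varphi_P:\mathbb R^+\times P\to P$ satisfy: (P1) $\varphi_X(0,\omega,x,\mu)=x$, $\varphi_P(0)\mu=\mu$; (P2) for $s,t\ge0$: $\varphi_X(t+s,\omega,x,\mu)=\varphi_X(t,\theta_s\omega,\varphi_X(s,\omega,x,\mu),\varphi_P(s)\mu)$ and $\varphi_P(t+s)\mu=\varphi_P(t)\varphi_P(s)\mu$; (P3) for all $t\ge0,\omega$, the map $(x,\mu)\mapsto(\varphi_X(t,\omega,x,\mu),\varphi_P(t)\mu)$ is continuous on $\mathbb X$; (P4) $\varphi_X$ is jointly measurable for $\mathcal B(\mathbb R^+)\otimes\mathcal F\otimes\mathcal B(X)\otimes\mathcal B(P)$ and $\varphi_P$ is jointly Borel measurable. Universes: $\mathfrak D_X$ is an inclusion-closed collection of families $\{B_X(\omega)\}_{\omega\in\Omega}$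 of nonempty subsets of $X$, $\mathfrak D_P$ an inclusion-closed collection of nonempty subsets of $P$ (inclusion closed: nonempty (families of) subsets of members are members). $\mathfrak D$ consists of all families $D=\{D(\omega)\}_{\omega\in\Omega}$ of nonempty subsets of $\mathbb X$ for which there are $B_X\in\mathfrak D_X$, $B_P\in\mathfrak D_P$ with $D(\omega)\subset B_X(\omega)\times B_P$ for all $\omega$. For a metric space, $\operatorname{dist}(C_1,C_2)=\sup_{z\in C_1}\inf_{a\in C_2}d(z,a)$; subscripts $\mathbb X$, $X$, $P$ indicate the space. A random compact set is a family of nonempty compact sets $C(\omega)$ such that $\omega\mapsto\inf_{a\in C(\omega)}d_{\mathbb X}(z,a)$ is measurable for every $z\in\mathbb X$. A random compact set $\mathcal A$ is a $\mathfrak D$-pullback random attractor if $\mathcal A\in\mathfrak D$, $\Phi(t,\omega)\mathcal A(\omega)=\mathcal A(\theta_t\omega)$ for $t\ge0$, and $\lim_{t\to\infty}\operatorname{dist}_{\mathbb X}(\Phi(t,\theta_{-t}\omega)D(\theta_{-t}\omega),\mathcal A(\omega))=0$ for all $D\in\mathfrak D$, $\omega\in\Omega$. A nonempty compact set $\mathcal A_P\subset P$ is a $\mathfrak D_P$-global attractor for $\varphi_P$ if $\varphi_P(t)\mathcal A_P=\mathcal A_P$ for all $t\ge0$ and $\lim_{t\to\infty}\operatorname{dist}_P(\varphi_P(t)B_P,\mathcal A_P)=0$ for all $B_P\in\mathfrak D_P$. (Under the stated hypotheses the sets $\Theta_{-t}\mu$ and $A(\omega,\mu)$ are nonempty and compact.)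 *)

(* Defs.v *)
From HB Require Import structures.
From mathcomp Require Import all_boot all_order all_algebra.
From mathcomp Require Import all_classical all_reals all_analysis.
From mathcomp Require Import measurable_realfun.

Set Implicit Arguments.
Unset Strict Implicit.
Unset Printing Implicit Defensive.

Import Order.TTheory GRing.Theory Num.Theory.
Import numFieldNormedType.Exports.

Local Open Scope classical_set_scope.
Local Open Scope ring_scope.

(* The base point is only there because measurable types are pointed. *)
#[short(type="completePMetricType")]
HB.structure Definition CompletePMetric (K : numDomainType) :=
  {T of Metric K T & Complete T & Pointed T}.

Notation borel T := (g_sigma_algebraType (@open T)).

Definition separable (T : topologicalType) : Prop :=
  exists S : set T, countable S /\ dense S.

Section wasserstein.
Context (R : realType) (X : completeNormedModType R).

Definition second_moment (mu : probability (borel X) R) : \bar R :=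
  (\int[mu]_x (`|x : X| ^+ 2)%:E)%E.

Definition couplings (mu nu : probability (borel X) R) :
    set (probability (borel X * borel X)%type R) :=
  [set gamma | forall A : set (borel X), measurable A ->
     gamma (A `*` setT) = mu A /\ gamma (setT `*` A) = nu A].

Definition wasserstein2 (mu nu : probability (borel X) R) : \bar R :=
  poweR (ereal_inf [set (\int[gamma]_z (`|(z.1 : X) - (z.2 : X)| ^+ 2)%:E)%E
                   | gamma in couplings mu nu]) (2^-1).

(* [iota] identifies the metric space [P] with a subspace of
   (P_2(X), W_2); it is injective because [mdist] separates points. *)
Definition wasserstein_subspace (P : metricType R)
    (iota : P -> probability (borel X) R) : Prop :=
  (forall mu : P, (second_moment (iota mu) < +oo)%E) /\
  (forall mu nu : P, (mdist mu nu)%:E = wasserstein2 (iota mu) (iota nu)).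

End wasserstein.

Section semidistance.
Context (R : realType) (T : Type) (d : T -> T -> R).

Definition pt_dist (z : T) (C : set T) : \bar R :=
  ereal_inf [set (d z a)%:E | a in C].

Definition semidist (C1 C2 : set T) : \bar R :=
  ereal_sup [set pt_dist z C2 | z in C1].

End semidistance.

Definition norm_dist (R : realType) (X : completeNormedModType R) (x y : X) : R :=
  `|x - y|.

Definition prod_dist (R : realType) (X : completeNormedModType R)
    (P : metricType R) (z w : X * P) : R :=
  norm_dist z.1 w.1 + mdist z.2 w.2.

Record metric_dynamical_system (R : realType) (dO : measure_display)
    (Omega : measurableType dO) (Pr : probability Omega R)
    (theta : R -> Omega -> Omega) : Prop := {
  mds_measurable : measurable_fun setT
    (fun z : measurableTypeR R * Omega => theta z.1 z.2) ;
  mds_0 : forall w, theta 0 w = w ;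
  mds_add : forall s t w, theta (s + t) w = theta s (theta t w) ;
  mds_preserving : forall t (E : set Omega), measurable E ->
    Pr (theta t @^-1` E) = Pr E }.

Section product_cocycle.
Context (R : realType) (dO : measure_display) (Omega : measurableType dO).
Context (X : completeNormedModType R) (P : completePMetricType R).
Variables (theta : R -> Omega -> Omega).
Variables (phiX : R -> Omega -> X -> P -> X) (phiP : R -> P -> P).

Definition product_map (t : R) (w : Omega) (z : X * P) : X * P :=
  (phiX t w z.1 z.2, phiP t z.2).

(* Time is real-valued; the values of [phiX] and [phiP] at negative times are
   unconstrained and never used. *)
Record product_cocycle : Prop := {
  phiX_0 : forall w x mu, phiX 0 w x mu = x ;
  phiP_0 : forall mu, phiP 0 mu = mu ;
  phiX_add : forall s t : R, 0 <= s -> 0 <= t -> forall w x mu,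
    phiX (t + s) w x mu = phiX t (theta s w) (phiX s w x mu) (phiP s mu) ;
  phiP_add : forall s t : R, 0 <= s -> 0 <= t -> forall mu,
    phiP (t + s) mu = phiP t (phiP s mu) ;
  product_map_continuous : forall (t : R) w, 0 <= t -> continuous (product_map t w) ;
  phiX_measurable : measurable_fun ([set t : measurableTypeR R | (0 : R) <= t] `*` setT)
    (fun z : measurableTypeR R * (Omega * (borel X * borel P)) =>
       phiX z.1 z.2.1 z.2.2.1 z.2.2.2 : borel X) ;
  phiP_measurable : measurable_fun ([set t : measurableTypeR R | (0 : R) <= t] `*` setT)
    (fun z : measurableTypeR R * borel P => phiP z.1 z.2 : borel P) }.

Record family_universe (DX : set (Omega -> set X)) : Prop := {
  family_universe_nonempty : forall B, DX B -> forall w, B w !=set0 ;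
  family_universe_closed : forall B C, DX B ->
    (forall w, C w !=set0 /\ C w `<=` B w) -> DX C }.

Record set_universe (DP : set (set P)) : Prop := {
  set_universe_nonempty : forall B, DP B -> B !=set0 ;
  set_universe_closed : forall B C, DP B -> C !=set0 -> C `<=` B -> DP C }.

Definition product_universe (DX : set (Omega -> set X)) (DP : set (set P)) :
    set (Omega -> set (X * P)) :=
  [set D | (forall w, D w !=set0) /\
     exists BX BP, [/\ DX BX, DP BP & forall w, D w `<=` BX w `*` BP]].

(* [compact] refers to the product topology, which is the topology of
   [prod_dist]. *)
Record random_compact_set (C : Omega -> set (X * P)) : Prop := {
  rcs_nonempty : forall w, C w !=set0 ;
  rcs_compact : forall w, compact (C w) ;
  rcs_measurable : forall z : X * P,
    measurable_fun setT
      ((fun w => pt_dist (@prod_dist R X P) z (C w)) : Omega -> \bar R) }.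

Record pullback_random_attractor (DD : set (Omega -> set (X * P)))
    (A : Omega -> set (X * P)) : Prop := {
  pra_random_compact : random_compact_set A ;
  pra_mem : DD A ;
  pra_invariant : forall (t : R) w, 0 <= t -> product_map t w @` A w = A (theta t w) ;
  pra_attracts : forall D, DD D -> forall w,
    semidist (@prod_dist R X P)
      (product_map t (theta (- t) w) @` D (theta (- t) w)) (A w)
      @[t --> +oo%R] --> 0%E }.

Record global_attractor (DP : set (set P)) (AP : set P) : Prop := {
  ga_nonempty : AP !=set0 ;
  ga_compact : compact AP ;
  ga_invariant : forall t : R, 0 <= t -> phiP t @` AP = AP ;
  ga_attracts : forall B, DP B ->
    semidist (@mdist R P) (phiP t @` B) AP @[t --> +oo%R] --> 0%E }.

Definition Theta_preim (AP : set P) (t : R) (mu : P) : set P :=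
  [set nu | AP nu /\ phiP t nu = mu].

Definition fiber (A : Omega -> set (X * P)) (w : Omega) (mu : P) : set X :=
  [set x | A w (x, mu)].

Definition phiX_image (t : R) (w : Omega) (C : set X) (mu : P) : set X :=
  [set phiX t w x mu | x in C].

End product_cocycle.

(* Main.v *)
Require Import Defs.
From mathcomp Require Import all_boot all_order all_algebra.
From mathcomp Require Import all_classical all_reals all_analysis.
From mathcomp Require Import lra.
Import Order.TTheory GRing.Theory Num.Theory.
Import numFieldNormedType.Exports.
Local Open Scope classical_set_scope.
Local Open Scope ring_scope.

(** The attractor is invariant, [A w = Phi t (A (theta (- t) w))], and the
    second component of [Phi] evolves on its own. Reading the invariance on the
    fibre over [mu] gives the first formula, except that a point [(y, nu)] of
    the attractor could a priori have its measure [nu] outside [AP]. It cannot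
    ([attractor_snd]): the measures of [A w] are, for every [t], [phiP t]-images
    of measures in one fixed set of the universe [DP], so they are at distance
    zero from the compact set [AP].

    For the pullback attraction, [B] times [AP] belongs to the product universe
    because [AP] belongs to [DP], so its image is eventually [d]-close to [A w].
    The points of that image coming from [nu] in [Theta_preim phiP AP t mu] have
    second component exactly [mu], whatever [t] and [nu] are; the bound is
    therefore uniform in [nu], and it remains to convert closeness to the whole
    compact set [A w] into closeness to its slice over [mu]. This is
    [compact_slice_close]: for a compact [K], the slices [K_m] with [m] close to
    [mu] lie in a small neighbourhood of [K_mu]. *)

Lemma semidist_lt {R : realType} {T : Type} {d : T -> T -> R} {C1 C2 : set T}
    {e : R} {z : T} :
  (semidist d C1 C2 < e%:E)%E -> C1 z -> exists2 a, C2 a & d z a < e.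
Proof.
move=> C12e C1z.
have : (pt_dist d z C2 < e%:E)%E.
  by apply: le_lt_trans C12e; apply: ereal_sup_ubound; exists z.
by move=> /ereal_inf_lt[_ [a C2a <-]]; rewrite lte_fin; exists a.
Qed.

Lemma semidist_le {R : realType} {T : Type} {d : T -> T -> R} {C1 C2 : set T}
    {e : R} :
  (forall z, C1 z -> exists2 a, C2 a & d z a <= e) ->
  (semidist d C1 C2 <= e%:E)%E.
Proof.
move=> C12e; apply: ge_ereal_sup => _ [z C1z <-].
have [a C2a zae] := C12e z C1z.
by apply: ge_ereal_inf; exists (d z a)%:E; [exists a | rewrite lee_fin].
Qed.

(** The supremum of the empty set is [-oo], whence the nonemptiness of [C1]. *)
Lemma semidist_ge0 {R : realType} {T : Type} {d : T -> T -> R} {C1 C2 : set T} :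
  (forall x y, 0 <= d x y) -> C1 !=set0 -> (0 <= semidist d C1 C2)%E.
Proof.
move=> d_ge0 [z C1z]; apply: (@le_trans _ _ (pt_dist d z C2)).
  by apply: le_ereal_inf_tmp => _ [a _ <-]; rewrite lee_fin.
by apply: ereal_sup_ubound; exists z.
Qed.

Lemma cvge0_lt {R : realType} {I : Type} {F : set_system I} {FF : Filter F}
    {f : I -> \bar R} {e : R} :
  f x @[x --> F] --> 0%E -> 0 < e -> \forall x \near F, (f x < e%:E)%E.
Proof. by move=> f0 e0; exact: (f0 _ (@nbhs_open_ereal_lt R 0 (fun=> e) e0)). Qed.

Lemma cvge0_ge0_le {R : realType} {I : Type} {F : set_system I}
    {FF : Filter F} {f : I -> \bar R} :
  (forall e : R, 0 < e -> \forall x \near F, (0 <= f x <= e%:E)%E) ->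
  f x @[x --> F] --> 0%E.
Proof.
move=> fe; apply/fine_cvgP; split.
  apply: filterS (fe 1 ltr01) => x /andP[f0 f1].
  by rewrite ge0_fin_numE// (le_lt_trans f1)// ltry.
apply/cvgrPdist_le => e e0; apply: filterS (fe e e0) => x /andP[f0 fxe] /=.
have fx : f x \is a fin_num by rewrite ge0_fin_numE// (le_lt_trans fxe)// ltry.
by rewrite sub0r normrN ger0_norm ?fine_ge0// -lee_fin fineK.
Qed.

Lemma compact_mdist0 {R : realType} {T : metricType R} {K : set T} {z : T} :
  compact K -> (forall e : R, 0 < e -> exists2 a, K a & mdist z a < e) -> K z.
Proof.
move=> cK near_K.
have /closure_id -> := compact_closed (@metric_hausdorff R T) cK => U.
move=> /metricType_numDomainType.nbhs_mdistP[e e0 eU].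
by have [a Ka zae] := near_K e e0; exists a; split=> //; exact: eU.
Qed.

(** Upper semicontinuity of the slices of a compact set. Every point [(a, m)]
    of [K] has a neighbourhood on which, for all small [d], the implication
    below holds: near a point with [m = mu] its conclusion does, while near any
    other point [mdist mu m] stays away from zero. Compactness then gives one
    [d] for all of [K]. *)
Lemma compact_slice_usc {R : realType} {X : normedModType R} {P : metricType R}
    {K : set (X * P)} (mu : P) {e : R} : compact K -> 0 < e ->
  \forall d \near 0^'+, forall z, K z -> mdist mu z.2 < d ->
    exists2 b, K (b, mu) & `|z.1 - b| < e.
Proof.
move=> /compact_near_coveringP cK e0.
apply: (cK _ _ (fun (d : R) (z : X * P) => mdist mu z.2 < d ->
  exists2 b, K (b, mu) & `|z.1 - b| < e)) => -[a m] Kam.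
have [mmu|mmu] := eqVneq m mu.
  have za : \forall z \near (a, m), `|a - z.1| < e.
    have xa : \forall x \near a, `|a - x| < e by exact: cvgr_dist_lt.
    exact: (@cvg_fst X P (nbhs a) (nbhs m) _ _ xa).
  exists ([set z | `|a - z.1| < e], setT); first by split=> //; exact: filterT.
  by move=> [z d] [/= zae _] _; exists a; [rewrite -mmu | rewrite distrC].
have r0 : 0 < mdist mu m / 2 by rewrite divr_gt0// mdist_gt0 eq_sym.
have zm : \forall z \near (a, m), mdist m z.2 < mdist mu m / 2.
  have nm : \forall n \near m, mdist m n < mdist mu m / 2.
    exact: metricType_numDomainType.cvgr_dist_lt.
  exact: (@cvg_snd X P (nbhs a) (nbhs m) _ _ nm).
exists ([set z | mdist m z.2 < mdist mu m / 2],
        [set d | d < mdist mu m / 2]); first by split=> //; exact: nbhs_right_lt.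
move=> [z d] [/= zmr dr] muz; exfalso.
have := metric_triangle mu z.2 m; rewrite (metric_sym z.2); lra.
Qed.

(** Any [z] in [K] that is [d]-close to [(x, mu)] is close to it in both
    components: the measures being close puts [z.1] near the slice over [mu], and
    [x] is near [z.1]. *)
Lemma compact_slice_close {R : realType} {X : completeNormedModType R}
    {P : metricType R} {K : set (X * P)} (mu : P) {e : R} : compact K -> 0 < e ->
  exists2 d : R, 0 < d & forall x z, K z -> @prod_dist R X P (x, mu) z < d ->
    exists2 b, K (b, mu) & norm_dist x b < e.
Proof.
move=> cK e0; have e20 : 0 < e / 2 by rewrite divr_gt0.
have [d [slice_d [d0 de]]] := filter_ex (filterI (compact_slice_usc mu cK e20)
  (filterI (nbhs_right_gt (0 : R)) (nbhs_right_lt e20))).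
exists d => // x [a m] Kam.
rewrite /prod_dist /norm_dist /= => xam.
have := mdist_ge0 mu m; have := normr_ge0 (x - a) => ? ?.
have [|b Kb abe] := slice_d _ Kam; first by rewrite /=; lra.
exists b => //; rewrite /= in abe de.
by have := ler_distD a x b; lra.
Qed.

Lemma attractor_pullback {R : realType} {dO : measure_display}
    {Omega : measurableType dO} {Pr : probability Omega R}
    {theta : R -> Omega -> Omega} {X : completeNormedModType R}
    {P : completePMetricType R} {phiX : R -> Omega -> X -> P -> X}
    {phiP : R -> P -> P} {DD : set (Omega -> set (X * P))}
    {A : Omega -> set (X * P)} (t : R) (w : Omega) :
  metric_dynamical_system Pr theta ->
  pullback_random_attractor theta phiX phiP DD A -> 0 <= t ->
  product_map phiX phiP t (theta (- t) w) @` A (theta (- t) w) = A w.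
Proof.
move=> Htheta HA t0.
by rewrite (pra_invariant HA)// -(mds_add Htheta) subrr (mds_0 Htheta).
Qed.

(** By invariance [mu] lies in [phiP t @` BP] for every [t >= 0], where [BP] is
    a member of [DP] that bounds the measures of all the [A w] at once. *)
Lemma attractor_snd {R : realType} {dO : measure_display}
    {Omega : measurableType dO} {Pr : probability Omega R}
    {theta : R -> Omega -> Omega} {X : completeNormedModType R}
    {P : completePMetricType R} {phiX : R -> Omega -> X -> P -> X}
    {phiP : R -> P -> P} {DX : set (Omega -> set X)} {DP : set (set P)}
    {A : Omega -> set (X * P)} {AP : set P} {w : Omega} {x : X} {mu : P} :
  metric_dynamical_system Pr theta ->
  pullback_random_attractor theta phiX phiP (product_universe DX DP) A ->
  global_attractor phiP DP AP -> A w (x, mu) -> AP mu.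
Proof.
move=> Htheta HA HAP Axmu.
have [_ [BX [BP [_ DBP sub]]]] := pra_mem HA.
apply: (compact_mdist0 (ga_compact HAP)) => e e0.
have [t [t0 te]] := filter_ex (filterI (nbhs_pinfty_ge (num_real (0 : R)))
  (cvge0_lt (ga_attracts HAP DBP) e0)).
apply: (semidist_lt te).
move: Axmu; rewrite -(attractor_pullback t w Htheta HA t0).
by move=> [[y nu] /sub[_ BPnu] [_ <-]]; exists nu.
Qed.

Theorem theorem2p5 (R : realType)
    (dO : measure_display) (Omega : measurableType dO) (Pr : probability Omega R)
    (theta : R -> Omega -> Omega)
    (Htheta : metric_dynamical_system Pr theta)
    (X : completeNormedModType R) (HX : separable X)
    (P : completePMetricType R) (HP : separable P)
    (iota : P -> probability (borel X) R) (Hiota : wasserstein_subspace iota)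
    (phiX : R -> Omega -> X -> P -> X) (phiP : R -> P -> P)
    (Hphi : product_cocycle theta phiX phiP)
    (DX : set (Omega -> set X)) (DP : set (set P))
    (HDX : family_universe DX) (HDP : set_universe DP)
    (A : Omega -> set (X * P)) (AP : set P)
    (HA : pullback_random_attractor theta phiX phiP (product_universe DX DP) A)
    (HAP : global_attractor phiP DP AP)
    (HAPD : DP AP)
    (HDX0 : DX !=set0) :
  (forall (t : R) (w : Omega) (mu : P), 0 <= t -> AP mu ->
     fiber A w mu =
     \bigcup_(nu in Theta_preim phiP AP t mu)
       phiX_image phiX t (theta (- t) w) (fiber A (theta (- t) w) nu) nu)
  /\
  (forall (B : Omega -> set X) (w : Omega) (mu : P), DX B -> AP mu ->
     ereal_sup [set semidist (@norm_dist R X)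
                  (phiX_image phiX t (theta (- t) w) (B (theta (- t) w)) nu)
                  (fiber A w mu)
               | nu in Theta_preim phiP AP t mu]
     @[t --> +oo%R] --> 0%E).
Proof.
split=> [t w mu t0 APmu|B w mu DB APmu].
  apply/seteqP; split=> [x Axmu|x [nu [APnu numu] [y Aynu <-]]].
    move: (Axmu); rewrite /fiber /= -(attractor_pullback t w Htheta HA t0).
    move=> [[y nu] Aynu [<- numu]]; exists nu; last by exists y.
    by split=> //; exact: (attractor_snd Htheta HA HAP Aynu).
  rewrite /fiber /= -(attractor_pullback t w Htheta HA t0).
  by exists (y, nu) => //; rewrite /product_map /= numu.
have DBAP : product_universe DX DP (fun w => B w `*` AP).
  split; last by exists B, AP; split=> // w'; exact: subset_refl.
  move=> w'; have [x Bx] := family_universe_nonempty HDX DB w'.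
  by exists (x, mu).
apply: cvge0_ge0_le => e e0.
have [d d0 slice_d] :=
  compact_slice_close mu (rcs_compact (pra_random_compact HA) (w := w)) e0.
apply: filterS (filterI (nbhs_pinfty_ge (num_real (0 : R)))
  (cvge0_lt (pra_attracts HA DBAP w) d0)) => t [t0 td]; apply/andP; split.
  (* Invariance of [AP] makes the index set of the supremum nonempty. *)
  have [nu APnu numu] : (phiP t @` AP) mu by rewrite (ga_invariant HAP).
  have [x Bx] := family_universe_nonempty HDX DB (theta (- t) w).
  apply: le_trans (ereal_sup_ubound _); last by exists nu.
  apply: semidist_ge0 => [? ?|]; first exact: normr_ge0.
  by exists (phiX t (theta (- t) w) x nu); exists x.
apply: ge_ereal_sup => _ [nu [APnu numu] <-].
apply: semidist_le => _ [x Bx <-].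
have [|z Az zd] := semidist_lt (z := (phiX t (theta (- t) w) x nu, mu)) td.
  by exists (x, nu) => //; rewrite /product_map /= numu.
by have [b Ab /ltW xb] := slice_d _ _ Az zd; exists b.
Qed.
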